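(* Let $p(n)$ denote the number of integer partitions of a nonnegative integer $n$, and set $p(-k)=0$ for every positive integer $k$. Then for all integers $N$ and $\ell$, $$V_d\left(\ell,\,N+\frac{|\ell|(|\ell|+1)}{2}\right)=\sum_{n\ge 0}\left(\frac{-3}{2n+1}\right)p\left(N-\frac{2n(n+1)}{3}-n|\ell|\right),$$ where $\left(\frac{-3}{\cdot}\right)$ is the Kronecker symbol (so $\left(\frac{-3}{2n+1}\right)$ equals $1$ if $n\equiv 0 \pmod 3$, $0$ if $n\equiv 1\pmod 3$, and $-1$ if $n\equiv 2\pmod 3$). In particular, for all integers $m,n$ with $0\le n<\frac{|m|(|m|+5)}{2}+4$, $$V_d(m,n)=p\left(n-\frac{|m|(|m|+1)}{2}\right).$$
   Context: A strongly concave composition of a nonnegative integer $n$ is a finite sequence of nonnegative integers $(a_1,\dots,a_s)$, $s\ge 1$, summing to $n$, such that for some index $k$ with $1\le k\le s$ one has $a_1>a_2>\dots>a_{k-1}>a_k<a_{k+1}<\dots<a_s$; $a_k$ is called the central part. Its rank is $s-2k+1$. $V_d(m,n)$ denotes the number of strongly concave compositions of $n$ with rank $m$ (and $V_d(m,n)=0$ for $n<0$). $p(n)$ is the partition function, with $p(n)=0$ for negative integers $n$. *)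

(* Defs.v *)
From HB Require Import structures.
From mathcomp Require Import all_boot all_order all_algebra.
Set Implicit Arguments. Unset Strict Implicit. Unset Printing Implicit Defensive.
Import Order.TTheory GRing.Theory Num.Theory.

(* a = (a_1,...,a_s) is strongly concave with central index k = k0+1
   (0-indexed k0 < s): a_1 > ... > a_k < a_{k+1} < ... < a_s.
   Its rank is s - 2k + 1 = s - 2*k0 - 1. *)
Definition sc_rank (a : seq nat) (m : int) : bool :=
  [exists k0 : 'I_(size a),
     [&& sorted gtn (take k0.+1 a), sorted ltn (drop k0 a)
       & ((size a)%:Z - 2 * (k0 : nat)%:Z - 1 == m)%R]].

(* Number of strongly concave compositions of n (n : nat) with rank m.
   Such a composition has at most 2n+1 parts (at most n distinct positive
   parts on each side of the central part), and every part is <= n, so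
   enumerating s-tuples with entries in 'I_n.+1 for s <= 2n+1 is exhaustive. *)
Definition Vd_nat (m : int) (n : nat) : nat :=
  \sum_(s < (2 * n).+2)
     #|[set t : s.-tuple 'I_n.+1 |
         (sumn (map val t) == n) && sc_rank (map val t) m]|.

Definition V_d (m n : int) : nat :=
  match n with Posz k => Vd_nat m k | Negz _ => 0%N end.

(* Partitions of n: nonincreasing sequences of positive integers summing to n;
   a partition of n has at most n parts, each <= n. *)
Definition part_nat (n : nat) : nat :=
  \sum_(s < n.+1)
     #|[set t : s.-tuple 'I_n.+1 |
         [&& sorted geq (map val t), all (fun x => 0 < x)%N (map val t)
           & sumn (map val t) == n]]|.

Definition p (z : int) : nat :=
  match z with Posz k => part_nat k | Negz _ => 0%N end.

Definition kron_m3 (k : nat) : int :=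
  if k %% 3 == 0 then 0%R else if k %% 3 == 1 then 1%R else (-1)%R.

(* Main.v *)
Require Import Defs.
From HB Require Import structures.
From mathcomp Require Import all_boot all_order all_algebra.
From mathcomp Require Import ring zify.
Import Order.TTheory GRing.Theory Num.Theory.
Local Open Scope ring_scope.
Set Implicit Arguments.
Unset Strict Implicit.
Unset Printing Implicit Defensive.

(** Let [l = |rank|].  Splitting a composition at its central part [c] into two
    sets of [r] and [r + l] distinct parts larger than [c], and summing over [c],
    gives for rank [l] the generating function [q^(l(l+1)/2) U_l], where
<<
      U_l = sum_r q^(r(r+l+1)) / ((q)_r (q)_(r+l) (1 - q^(2r+l+1))).
>>
    Writing the summand as [q^(r(r+l+1)) [2r+l, r] / (q)_(2r+l+1)] and using both
    q-Pascal rules on the Gaussian binomial, the Durfee rectangle identity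
    [sum_n q^(n(n+d)) / ((q)_n (q)_(n+d)) = 1/(q)_oo] yields
<<
      U_l = (1 - q^(2l+4)) / (q)_oo + q^(3l+8) U_(l+4),
>>
    and iterating produces the terms [n = 3j] and [n = 3j+2] of the formula.
    Coefficients of [q^m] are compared in a ring where [q^(m+1) = 0], so that all
    sums and products are finite. *)

(** * q-series identities modulo q^(m+1) *)

Section NilpotentSeries.
Variables (R : comNzRingType) (q : R) (m : nat).
Hypothesis q_nil : q ^+ m.+1 = 0.

Lemma expr_nil n : (m < n)%N -> q ^+ n = 0.
Proof. by move=> lt_mn; rewrite -(subnK lt_mn) exprD q_nil mulr0. Qed.

(** Stands for 1/(1 - q^i) when i > 0. The index [c] later becomes the central part of a
    composition. *)
Definition geom i : R := \sum_(c < m.+1) q ^+ (c * i).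

(** Stands for 1/(q)_k, and for 1/(q)_oo as soon as k >= m, by [invqfact_big]. *)
Fixpoint invqfact k : R := if k is k'.+1 then invqfact k' * geom k else 1.

Lemma geomK i : (0 < i)%N -> geom i * (1 - q ^+ i) = 1.
Proof.
move=> i_gt0; rewrite /geom.
under eq_bigr do rewrite mulnC exprM.
have := subrX1 (q ^+ i) m.+1; rewrite -exprM (@expr_nil (i * m.+1)) ?leq_pmull // => E.
by rewrite mulrC -[1 - _]opprB mulNr -E sub0r opprK.
Qed.

Lemma geom_big i : (m < i)%N -> geom i = 1.
Proof.
move=> lt_mi; rewrite /geom big_ord_recl mul0n expr0 big1 ?addr0 // => j _.
by rewrite expr_nil // (leq_trans lt_mi) // leq_pmull.
Qed.

Lemma invqfactS k : invqfact k = invqfact k.+1 * (1 - q ^+ k.+1).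
Proof. by rewrite /= -mulrA geomK // mulr1. Qed.

Lemma invqfact_big k : (m <= k)%N -> invqfact k = invqfact m.
Proof.
by move/subnK <-; elim: (k - m)%N => //= i <-; rewrite geom_big ?mulr1 //; lia.
Qed.

(* Partitions with Durfee rectangle [n * (n + d)]. *)
Definition cauchy_term d n : R :=
  q ^+ (n * (n + d)) * invqfact n * invqfact (n + d).

(* The telescoping certificate
   [q^(n(n+d)) / ((q)_(n-1) (q)_(n+d))], zero at [n = 0]. *)
Definition cauchy_cert d n : R := (1 - q ^+ n) * cauchy_term d n.

(** Over the common factors [invqfact n.+1] and [invqfact (n + d).+1] this is a polynomial identity
    in powers of q. *)
Lemma cauchy_telescope d n :
  cauchy_term d n - cauchy_term d.+1 n = cauchy_cert d n - cauchy_cert d n.+1.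
Proof.
rewrite /cauchy_cert /cauchy_term !addnS addSn (invqfactS (n + d)).
have -> : (n * (n + d).+1 = n * (n + d) + n)%N by lia.
have -> : (n.+1 * (n + d).+1 = n * (n + d) + n + n + d + 1)%N by lia.
rewrite (invqfactS n) -addn1 -(addn1 (n + d)) !exprD expr1; ring.
Qed.

Lemma cauchy_term_big d n : (m < n)%N -> cauchy_term d n = 0.
Proof. by move=> lt_mn; rewrite /cauchy_term expr_nil ?mul0r //; nia. Qed.

(** By telescoping, the sum does not depend on [d]: the certificate vanishes at 0 through the factor
    1 - q^0, and at [K] because K > m. For d > m only the term n = 0 survives. *)
Lemma cauchy_sum d K : (m < K)%N ->
  \sum_(n < K) cauchy_term d n = invqfact m.
Proof.
move=> lt_mK.
have step e : \sum_(n < K) cauchy_term e n = \sum_(n < K) cauchy_term e.+1 n.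
  apply/eqP; rewrite -subr_eq0 -sumrB.
  rewrite (eq_bigr (fun i : 'I_K => - (cauchy_cert e i.+1 - cauchy_cert e i)));
    last by move=> i _; rewrite cauchy_telescope opprB.
  rewrite sumrN -(big_mkord xpredT (fun i => cauchy_cert e i.+1 - cauchy_cert e i)).
  rewrite telescope_sumr // /cauchy_cert cauchy_term_big // mulr0.
  by rewrite expr0 subrr mul0r subrr oppr0.
have shift k : \sum_(n < K) cauchy_term d n = \sum_(n < K) cauchy_term (d + k) n.
  by elim: k => [|k IH]; rewrite ?addn0 // addnS -step.
rewrite (shift m.+1); case: K lt_mK {step shift} => // K _.
rewrite big_ord_recl big1 => [|i _]; last first.
  by rewrite /cauchy_term expr_nil ?mul0r // lift0; nia.
by rewrite addr0 /cauchy_term mul0n expr0 !mul1r add0n invqfact_big //; lia.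
Qed.

Definition concave_term l n : R :=
  q ^+ (n * (n + l.+1)) * invqfact n * invqfact (n + l) * geom (n + n + l).+1.

Definition concave_sum l K : R := \sum_(n < K) concave_term l n.

(* Division-free form of the two q-Pascal rules for [2N + l, N], [N = n + 2]. *)
Lemma concave_term_rec l n :
  concave_term l n.+2 =
    cauchy_term l.+1 n.+2 - q ^+ (l.+2 + l.+2) * cauchy_term l.+3 n.+1
    + q ^+ (3 * l + 8) * concave_term l.+4 n.
Proof.
rewrite /concave_term /cauchy_term !(addnS, addSn).
set A := invqfact (n + l).+4.
have E3 : invqfact (n + l).+3 = A * (1 - q ^+ (n + l).+4) by rewrite -invqfactS.
have E2 : invqfact (n + l).+2 = A * (1 - q ^+ (n + l).+4) * (1 - q ^+ (n + l).+3).
  by rewrite invqfactS E3.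
rewrite E2 E3; set B := invqfact n.+2.
have F1 : invqfact n.+1 = B * (1 - q ^+ n.+2) by rewrite -invqfactS.
have F0 : invqfact n = B * (1 - q ^+ n.+2) * (1 - q ^+ n.+1) by rewrite invqfactS F1.
rewrite F1 F0; set G := geom _.
have G1 : G * (1 - q ^+ (n + n + l).+4.+1) = 1 by rewrite geomK.
have -> : (n.+2 * (n + l).+3 = n * n + n * l + n + n + n + n + n + l + l + 6)%N by lia.
have -> : (n.+1 * (n + l).+4 = n * n + n * l + n + n + n + n + n + l + 4)%N by lia.
have -> : (n * (n + l).+4.+1 = n * n + n * l + n + n + n + n + n)%N by lia.
have -> : ((3 * l + 0).+4.+4 = l + l + l + 8)%N by lia.
have -> : ((l + l).+4 = l + l + 4)%N by lia.
move: G1; rewrite -[(n + n + l).+4.+1]addn1 -[(n + n + l).+4]addn4.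
rewrite -[(n + l).+4]addn4 -[(n + l).+3]addn3 -[n.+2]addn2 -[n.+1]addn1.
rewrite !exprD expr1.
move: (q ^+ n) (q ^+ l) (q ^+ (n * n)) (q ^+ (n * l)) => x y u v G1.
set X := (X in X = _); set Y := (Y in _ = Y + _); set Z := (Z in _ = _ + Z).
(* Both concave terms contain [G], since 2(n+2) + l = 2n + (l+4), while the Durfee terms in [Y] do
   not. Multiplying [Y] by 1 = G(1 - q^(2n+l+5)) leaves a polynomial identity. *)
transitivity (Y * (G * (1 - x * x * y * q ^+ 4 * q)) + Z).
  rewrite /X /Y /Z; ring.
by rewrite G1 mulr1.
Qed.

Lemma concave_term_big l n : (m < n)%N -> concave_term l n = 0.
Proof. by move=> lt_mn; rewrite /concave_term expr_nil ?mul0r //; nia. Qed.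

(** Index n + 2 on the left meets index n on the right, whence [K.+2] and [K]. The terms 0 and 1 are
    boundary cases of [concave_term_rec], with the terms of negative index dropped. *)
Lemma concave_sum_rec l K : (m < K)%N ->
  concave_sum l K.+2 =
    (1 - q ^+ (l.+2 + l.+2)) * invqfact m + q ^+ (3 * l + 8) * concave_sum l.+4 K.
Proof.
move=> lt_mK.
have term0 : concave_term l 0 = cauchy_term l.+1 0.
  by rewrite /concave_term /cauchy_term !mul0n /= !mul1r !add0n.
have term1 : concave_term l 1 =
    cauchy_term l.+1 1 - q ^+ (l.+2 + l.+2) * cauchy_term l.+3 0.
  rewrite /concave_term /cauchy_term !mul0n !add0n !mul1n !add1n.
  have -> : ((1 + l).+2 = l.+3)%N by [].
  set g := geom l.+3.
  have G1 : invqfact 1 * (1 - q) = 1.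
    by rewrite -[X in 1 - X]expr1 -invqfactS.
  have G3 : g * (1 - q ^+ l.+3) = 1 by rewrite geomK.
  have -> : invqfact l.+3 = invqfact l.+2 * g by [].
  rewrite (invqfactS l.+1) exprD.
  move: G1 G3; rewrite !(exprS q l.+2) => G1 G3.
  move: (invqfact 1) (invqfact l.+2) (q ^+ l.+2) G1 G3 => a b x G1 G3.
  transitivity (x * a * b * (g * (1 - q * x))
     - x * x * b * g * (a * (1 - q))); first by ring.
  by rewrite G1 G3 /=; ring.
have -> : concave_sum l K.+2 =
    \sum_(n < K.+2) cauchy_term l.+1 n
    - q ^+ (l.+2 + l.+2) * (\sum_(n < K.+1) cauchy_term l.+3 n)
    + q ^+ (3 * l + 8) * concave_sum l.+4 K.
  rewrite /concave_sum 4!big_ord_recl [in RHS]big_ord_recl term0 term1.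
  rewrite (eq_bigr (fun n : 'I_K => cauchy_term l.+1 n.+2
     - q ^+ (l.+2 + l.+2) * cauchy_term l.+3 n.+1
     + q ^+ (3 * l + 8) * concave_term l.+4 n)); last first.
    by move=> n _; exact: concave_term_rec.
  rewrite big_split sumrB -!mulr_sumr /=.
  rewrite -[bump 0 0]/1%N; ring.
by rewrite !cauchy_sum; [ring | lia | lia].
Qed.

(** The exponent 6J^2 + 2J + 3Jl is the sum of 3(l + 4i) + 8 over i < J. Step j contributes this
    power, taken at J = j, times 1 - q^(2(l+4j)+4). *)
Lemma concave_sum_iter l J K : (m < K)%N ->
  concave_sum l (K + J.*2) =
    invqfact m * (\sum_(j < J) (q ^+ (6 * j * j + 2 * j + 3 * j * l)
                     - q ^+ (6 * j * j + 10 * j + 4 + (3 * j + 2) * l)))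
    + q ^+ (6 * J * J + 2 * J + 3 * J * l) * concave_sum (l + 4 * J) K.
Proof.
move=> lt_mK; elim: J K lt_mK => [|J IHJ] K lt_mK.
  by rewrite big_ord0 !muln0 !addn0 mulr0 expr0 mul1r add0r.
have -> : (K + J.+1.*2 = K.+2 + J.*2)%N by lia.
rewrite IHJ; last by lia.
rewrite concave_sum_rec // big_ord_recr /=.
have -> : (l + 4 * J).+4 = (l + 4 * J.+1)%N by lia.
set e := (6 * J * J + 2 * J + 3 * J * l)%N.
have -> : (6 * J * J + 10 * J + 4 + (3 * J + 2) * l
           = e + ((l + 4 * J).+2 + (l + 4 * J).+2))%N by rewrite /e; lia.
have -> : (6 * J.+1 * J.+1 + 2 * J.+1 + 3 * J.+1 * l
           = e + (3 * (l + 4 * J) + 8))%N by rewrite /e; lia.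
rewrite !(exprD q e); ring.
Qed.

Lemma concave_sum_eq l K J : (m < K)%N -> (m < J)%N ->
  concave_sum l K =
    invqfact m * (\sum_(j < J) (q ^+ (6 * j * j + 2 * j + 3 * j * l)
                     - q ^+ (6 * j * j + 10 * j + 4 + (3 * j + 2) * l))).
Proof.
move=> lt_mK lt_mJ.
(* Terms of index above m vanish, so [K] can be enlarged by the [J.*2] that the iteration
   consumes. *)
have stab L : concave_sum l (K + L) = concave_sum l K.
  elim: L => [|L IHL]; first by rewrite addn0.
  rewrite addnS /concave_sum big_ord_recr /= concave_term_big ?addr0 //.
  exact: leq_trans lt_mK (leq_addr _ _).
(* The remainder carries a power of q with exponent at least 2J > m. *)
rewrite -(stab J.*2) concave_sum_iter // (@expr_nil (_ + _)) ?mul0r ?addr0 //.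
by lia.
Qed.

End NilpotentSeries.

(** * Enumeration of partitions and compositions by lists without repetition *)

(** Replaces the cardinals in [part_nat] and [Vd_nat] by counts in a list built recursively, whose
    generating function can be computed. *)
Lemma sum_card_tuples (S B : nat) (P Q : pred (seq nat)) (L : seq (seq nat)) :
    uniq L ->
    (forall l, (l \in L) && Q l = [&& size l < S, all (fun x => x < B) l & P l])%N ->
  (\sum_(s < S) #|[set t : s.-tuple 'I_B | P (map val t)]|)%N = count Q L.
Proof.
move=> uL memL.
pose E s := [seq map val (t : seq 'I_B)
  | t : s.-tuple 'I_B in [set t : s.-tuple 'I_B | P (map val t)]].
have mapvalI : injective (fun l : seq 'I_B => map val l).
  exact: inj_map val_inj.
have memE s l : (l \in E s) = [&& size l == s, all (fun x => x < B)%N l & P l].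
  apply/imageP/and3P => [[t]|[/eqP sz /allP ltB Pl]].
    rewrite inE => Pt ->; split=> //; first by rewrite size_map size_tuple.
    apply/allP => _ /mapP[x _ ->]; exact: ltn_ord.
  have szl : size (pmap (fun x => insub x : option 'I_B) l) == s.
    by rewrite size_pmap_sub -sz -all_count; apply/allP.
  have lE : map val (Tuple szl) = l.
    rewrite /= (pmap_filter (insubK _)); apply/all_filterP/allP => x /ltB lt_xB.
    by rewrite /= isSome_insub.
  by exists (Tuple szl); rewrite ?inE lE.
have szE s : size (E s) = #|[set t : s.-tuple 'I_B | P (map val t)]|.
  by rewrite size_image.
under eq_bigr do rewrite -szE.
rewrite -(big_mkord xpredT (fun s => size (E s))).
transitivity (size [seq l | s <- index_iota 0 S, l <- E s]).
  by rewrite size_allpairs_dep sumnE big_map.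
rewrite -size_filter; apply/perm_size/uniq_perm.
- apply: allpairs_uniq_dep; first exact: iota_uniq.
    by move=> s _; rewrite map_inj_in_uniq ?enum_uniq // => t u _ _ /mapvalI/val_inj.
  move=> /= _ _ /allpairsPdep[s [l [_ ls ->]]] /allpairsPdep[t [k [_ kt ->]]] /= lk.
  move: ls kt; rewrite !memE lk => /and3P[/eqP-> _ _] /and3P[/eqP<- _ _].
  by [].
- exact: filter_uniq.
move=> l; rewrite mem_filter andbC memL; apply/allpairsPdep/and3P.
  by case=> s [k []]; rewrite memE mem_index_iota => /= ltsS /and3P[/eqP sk ? ?] ->; rewrite sk.
case=> ltS aB Pl; exists (size l), l; rewrite memE eqxx aB Pl.
by rewrite mem_index_iota.
Qed.

(** The recursion on the width of the range c+1 .. c+d branches on whether c+1 is used, so that the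
    generating function satisfies a two-term recurrence. *)
Fixpoint strict_lists c d k : seq (seq nat) :=
  if d is d'.+1 then
    strict_lists c.+1 d' k ++
      (if k is k'.+1 then map (cons c.+1) (strict_lists c.+1 d' k') else [::])
  else if k is 0%N then [:: [::]] else [::].

Lemma mem_strict_lists c d k l : (l \in strict_lists c d k) =
  [&& path ltn c l, size l == k & all (fun x => x <= c + d)%N l].
Proof.
elim: d c k l => [|d IHd] c k l /=.
  rewrite addn0; case: k l => [|k] [|x l] //=; rewrite ?andbF //.
  by rewrite in_nil; apply/esym/and3P => -[/andP[lt_cx _] _ /andP[le_xc _]]; lia.
rewrite mem_cat IHd addnS addSn.
have weaken x : path ltn c.+1 x -> path ltn c x.
  case: x => //= x s /andP[lt_cx ->]; rewrite andbT; exact: ltn_trans lt_cx.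
apply/orP/and3P => [[/and3P[/weaken pl sl al] //|]|[pl sl al]].
  case: k => [|k] //; case/mapP => s; rewrite IHd => /and3P[ps /eqP<- al] -> /=.
  by rewrite ltnS leqnn ps eqxx -addSn al leq_addr.
case: l pl sl al => [|x l] /= pl sl al; first by left; rewrite sl.
have [xc|xc] := eqVneq x c.+1; last first.
  by left; rewrite sl al !andbT; case/andP: pl => lt_cx ->; lia.
right; case: k sl => // k; rewrite eqSS => sl; rewrite xc map_f // IHd.
by rewrite sl; case/andP: pl al => _; rewrite xc => -> /andP[_].
Qed.

Lemma strict_lists_uniq c d k : uniq (strict_lists c d k).
Proof.
elim: d c k => [|d IHd] c [|k] //=; first by rewrite cats0.
rewrite cat_uniq IHd map_inj_uniq ?IHd ?andbT => [|x y []//].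
by apply/hasPn => _ /mapP[l _ ->]; rewrite /= mem_strict_lists /= ltnn.
Qed.

Lemma path_ltn_size c B l : path ltn c l -> (c <= B)%N -> all (fun x => x <= B)%N l ->
  (c + size l <= B)%N.
Proof.
elim: l c => [|x l IHl] c /=; first by rewrite addn0.
move=> /andP[lt_cx pl] _ /andP[le_xB al]; have := IHl x pl le_xB al; lia.
Qed.

(* Each part size in [1 .. m] occurs at most [n] times. *)
Fixpoint part_lists n m : seq (seq nat) :=
  if m is m'.+1 then [seq nseq i m ++ l | i <- iota 0 n.+1, l <- part_lists n m']
  else [:: [::]].

Lemma part_listsS n m : part_lists n m.+1 =
  [seq nseq i m.+1 ++ l | i <- iota 0 n.+1, l <- part_lists n m].
Proof. by []. Qed.

Lemma part_listsP n m l : l \in part_lists n m ->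
  sorted geq l /\ all (fun x => 0 < x <= m)%N l.
Proof.
elim: m l => [|m IHm] l; first by rewrite inE => /eqP->.
rewrite part_listsS; case/allpairsP=> -[i k] [_ /= /IHm[sk ak] ->].
have ak' : all (fun x => 0 < x <= m.+1)%N k.
  by apply: sub_all ak => x /andP[-> /leqW].
split; last by rewrite all_cat ak' andbT all_nseq /= ltnSn orbT.
elim: i => //= i; case: i => /= [_|i ->]; last by rewrite leqnn.
by case: k sk ak {ak'} => //= x k -> /andP[/andP[_ /leqW->]].
Qed.

Lemma mem_part_lists n m l : sorted geq l -> all (fun x => 0 < x <= m)%N l ->
  (size l <= n)%N -> l \in part_lists n m.
Proof.
elim: m l => [|m IHm] l sl al nl.
  by case: l al {sl nl} => //= x l /andP[/andP[lt0x lex0]]; lia.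
have [i [k [lE ak]]] :
    exists i k, l = nseq i m.+1 ++ k /\ all (fun x => 0 < x <= m)%N k.
  elim: l sl al {nl} => [|x l IHl] sl; first by exists 0%N, [::].
  move=> /= /andP[/andP[lt0x le_xm] al].
  have [xm|xm] := eqVneq x m.+1.
    have [i [k [-> ak]]] := IHl (path_sorted sl) al.
    by exists i.+1, k; rewrite xm.
  exists 0%N, (x :: l); split=> //=; apply/andP; split; first lia.
  have /allP lx : all (geq x) l.
    by apply: order_path_min sl => a b c /= ba cb; apply: leq_trans cb ba.
  by apply/allP => y yl; have := lx y yl; have := allP al y yl => /=; lia.
rewrite part_listsS; apply/allpairsP; exists (i, k).
move: sl nl; rewrite lE => /cat_sorted2[_ sk]; rewrite size_cat size_nseq => nl.
split=> //; first by rewrite mem_iota /=; lia.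
by apply: IHm => //=; lia.
Qed.

Lemma part_lists_uniq n m : uniq (part_lists n m).
Proof.
elim: m => // m IHm; rewrite part_listsS.
apply: allpairs_uniq => //; first exact: iota_uniq.
(* The other parts are at most m, so the number of copies of m+1 can be read off the list. *)
have cnt i k : k \in part_lists n m -> count_mem m.+1 (nseq i m.+1 ++ k) = i.
  case/part_listsP => _ /allP ak; rewrite count_cat count_nseq /= eqxx mul1n.
  rewrite (_ : count_mem _ _ = 0%N) ?addn0 //; apply/count_memPn/negP => /ak; lia.
move=> _ _ /allpairsP[[i k] [_ ki ->]] /allpairsP[[j h] [_ hj ->]] E.
have ij : i = j by rewrite -(cnt i k) // -(cnt j h) // [X in count_mem _ X]E.
by move/eqP: E; rewrite /= ij eqseq_cat // eqxx => /eqP->.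
Qed.

Lemma size_le_sumn l : all (fun x => 0 < x)%N l -> (size l <= sumn l)%N.
Proof. by elim: l => //= x l IHl /andP[lt0x /IHl]; lia. Qed.

Lemma leq_sumn x l : x \in l -> (x <= sumn l)%N.
Proof.
elim: l => //= y l IHl; rewrite inE => /orP[/eqP->|/IHl]; lia.
Qed.

(** One list for the bound [n] serves all j <= n: no partition of j has a part or a multiplicity
    above n. *)
Lemma part_natE n j : (j <= n)%N ->
  part_nat j = count (fun l => sumn l == j) (part_lists n n).
Proof.
move=> le_jn.
apply: (@sum_card_tuples _ _
  (fun l => [&& sorted geq l, all (fun x => 0 < x)%N l & sumn l == j]));
  first exact: part_lists_uniq.
move=> l; apply/andP/and3P => [[/part_listsP[sl al] /eqP sj]|].
  have a0 : all (fun x => 0 < x)%N l by apply: sub_all al => x /andP[].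
  split; first by rewrite ltnS -sj size_le_sumn.
    by apply/allP => x /leq_sumn; rewrite sj ltnS.
  by rewrite sl a0 sj eqxx.
case=> lt_lj al /and3P[sl a0 sj]; split=> //; apply: mem_part_lists => //.
  apply/allP => x xl; rewrite (allP a0 _ xl) /=.
  by have := allP al x xl => /=; lia.
by apply: leq_trans (size_le_sumn a0) _; rewrite (eqP sj).
Qed.

(** Both sides are stored outward from [c], hence increasing, so that each can be taken from
    [strict_lists]. *)
Definition join_concave (c : nat) (ab : seq nat * seq nat) : seq nat :=
  rev ab.1 ++ c :: ab.2.

(* [r] is the size of the smaller side. *)
Definition left_size (m : int) (r : nat) : nat := if 0 <= m then r else (r + `|m|)%N.
Definition right_size (m : int) (r : nat) : nat := if 0 <= m then (r + `|m|)%N else r.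

Definition concave_pairs n m (rc : nat * nat) :=
  [seq (a, b) | a <- strict_lists rc.2 (n - rc.2) (left_size m rc.1),
                b <- strict_lists rc.2 (n - rc.2) (right_size m rc.1)].

Definition concave_lists n m : seq (seq nat) :=
  [seq join_concave rc.2 ab
     | rc <- [seq (r, c) | r <- iota 0 n.+1, c <- iota 0 n.+1],
       ab <- concave_pairs n m rc].

(** The central part is recovered as the minimum, and the length of the left side as its index. *)
Lemma join_concave_inj c c' a a' b b' :
  path ltn c a -> path ltn c b -> path ltn c' a' -> path ltn c' b' ->
  join_concave c (a, b) = join_concave c' (a', b') -> [/\ c = c', a = a' & b = b'].
Proof.
have min d u v x : path ltn d u -> path ltn d v -> x \in join_concave d (u, v) ->
    (d <= x)%N.
  move=> /(order_path_min ltn_trans)/allP hu /(order_path_min ltn_trans)/allP hv.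
  by rewrite mem_cat mem_rev inE => /or3P[/hu/ltnW|/eqP->|/hv/ltnW].
have cin d u v : d \in join_concave d (u, v) by rewrite mem_cat inE eqxx orbT.
have idx d u v : path ltn d u -> index d (join_concave d (u, v)) = size u.
  move=> /(order_path_min ltn_trans)/allP hu; rewrite index_cat mem_rev /=.
  case: ifP => [/hu|_]; first by rewrite /= ltnn.
  by rewrite eqxx addn0 size_rev.
move=> pa pb pa' pb' E.
have cc : c = c'.
  apply/eqP; rewrite eqn_leq (@min c a b c') // ?E ?cin //.
  by rewrite (@min c' a' b' c) // -E cin.
have sa : size a = size a' by rewrite -(idx c a b) // E cc idx // -cc.
move/eqP: E; rewrite /join_concave /= eqseq_cat ?size_rev // => /andP[/eqP ra].
by case/eqP=> _ ->; split=> //; apply: (can_inj revK).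
Qed.

Lemma concave_lists_uniq n m : uniq (concave_lists n m).
Proof.
apply: allpairs_uniq_dep.
- by apply: allpairs_uniq; rewrite ?iota_uniq // => -[? ?] [? ?].
- move=> rc _; apply: allpairs_uniq; rewrite ?strict_lists_uniq //.
  by move=> [? ?] [? ?].
move=> _ _ /allpairsPdep[[r c] [[a b] [_ h ->]]]
  /allpairsPdep[[r' c'] [[a' b'] [_ h' ->]]] /= E.
case/allpairsP: h => -[a0 b0] /= []; rewrite !mem_strict_lists.
move=> /and3P[pa /eqP sa _] /and3P[pb /eqP sb _] [? ?]; subst a0 b0.
case/allpairsP: h' => -[a0 b0] /= []; rewrite !mem_strict_lists.
move=> /and3P[pa' /eqP sa' _] /and3P[pb' /eqP sb' _] [? ?]; subst a0 b0.
have [cc aa bb] := join_concave_inj pa pb pa' pb' E.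
subst c' a' b'; suff -> : r = r' by [].
by move: sa sb; rewrite sa' sb' /left_size /right_size; case: ifP; lia.
Qed.

(** With k0 = |a| and s = |a| + |b| + 1, the rank s - 2k0 - 1 is |b| - |a|. *)
Lemma sc_rankP t m : reflect
  (exists c a b, [/\ t = join_concave c (a, b), path ltn c a, path ltn c b
     & (size b)%:Z - (size a)%:Z = m]) (sc_rank t m).
Proof.
apply: (iffP existsP) => [[k /and3P[sk dk /eqP mk]]|[c [a [b [-> pa pb ab]]]]].
  exists (nth 0%N t k), (rev (take k t)), (drop k.+1 t).
  have tE : t = take k t ++ nth 0%N t k :: drop k.+1 t.
    by rewrite -drop_nth // cat_take_drop.
  split.
  - by rewrite /join_concave /= revK.
  - by move: sk; rewrite (take_nth 0%N) // -rev_sorted rev_rcons.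
  - by move: dk; rewrite (drop_nth 0%N).
  have ltk := ltn_ord k.
  by rewrite size_rev size_drop size_takel; lia.
have sz : (size a < size (join_concave c (a, b)))%N.
  by rewrite size_cat size_rev /=; lia.
exists (Ordinal sz) => /=; apply/and3P; split.
- rewrite /join_concave /= -cat_rcons take_cat size_rcons size_rev ltnn subnn.
  by rewrite take0 cats0 -rev_cons rev_sorted.
- by rewrite /join_concave /= drop_cat size_rev ltnn subnn drop0.
rewrite size_cat size_rev /=; lia.
Qed.

Lemma Vd_natE n m : Vd_nat m n = count (fun l => sumn l == n) (concave_lists n m).
Proof.
apply: (@sum_card_tuples _ _ (fun l => (sumn l == n) && sc_rank l m));
  first exact: concave_lists_uniq.
move=> l; apply/andP/and3P.
  case=> /allpairsPdep[[r c] [ab [/allpairsP[[r0 c0] [rI cI [? ?]]]]]]; subst r0 c0.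
  case/allpairsP=> -[a b] []; rewrite !mem_strict_lists /=.
  move: rI cI; rewrite !mem_iota /= => rI cI.
  move=> /and3P[pa /eqP sa la] /and3P[pb /eqP sb lb] -> -> sn.
  have cn : (c <= n)%N by lia.
  move: la lb; rewrite subnKC // => la lb.
  (* Each side has at most n - c parts, so the total length is at most 2n + 1, within the range of
     [Vd_nat]. *)
  have := path_ltn_size pa cn la; have := path_ltn_size pb cn lb => szb sza.
  split.
  - by rewrite size_cat size_rev /=; lia.
  - by rewrite all_cat all_rev /= ltnS cn la.
  rewrite sn /=; apply/sc_rankP; exists c, a, b; split=> //.
  by rewrite sa sb /left_size /right_size; case: ifP; lia.
case=> sl al /andP[sn /sc_rankP[c [a [b [lE pa pb ab]]]]]; split=> //.
move: al; rewrite lE all_cat all_rev /= ltnS => /and3P[la cn lb].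
have := path_ltn_size pa cn la; have := path_ltn_size pb cn lb => szb sza.
apply/allpairsPdep; exists (minn (size a) (size b), c), (a, b); split=> //.
  by apply/allpairsP; exists (minn (size a) (size b), c); rewrite !mem_iota /=; split=> //; lia.
apply/allpairsP; exists (a, b); rewrite !mem_strict_lists /= subnKC //.
by split=> //; apply/and3P; split=> //; rewrite /left_size /right_size; case: ifP; lia.
Qed.

(** * Generating functions of the enumerations *)

Section GeneratingFunctions.
Variables (R : comNzRingType) (q : R) (m : nat).
Hypothesis q_nil : q ^+ m.+1 = 0.
Local Notation invqfact := (invqfact q m).

Definition gf (L : seq (seq nat)) : R := \sum_(l <- L) q ^+ sumn l.

(** Subtracting c+1, ..., c+k from the k distinct parts leaves a partition into at most k parts.
    With c + d = m the upper bound on the parts is invisible modulo q^(m+1). *)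
Lemma gf_strict_lists c d k : (c + d)%N = m ->
  gf (strict_lists c d k) = q ^+ (c * k + 'C(k.+1, 2)) * invqfact k.
Proof.
rewrite /gf; elim: d c k => [|d IHd] c k cdm /=.
  case: k => [|k] /=; first by rewrite big_seq1 muln0 mulr1.
  (* Here c = m and the length is positive: there is no list, and the exponent on the right exceeds
     m. *)
  rewrite big_nil (expr_nil q_nil) ?mul0r //; rewrite binS bin1; nia.
rewrite big_cat IHd /=; last by rewrite -cdm addnS addSn.
case: k => [|k]; first by rewrite big_nil addr0 !muln0.
rewrite big_map; under eq_bigr do rewrite /= exprD.
rewrite -mulr_sumr IHd; last by rewrite -cdm addnS addSn.
rewrite (invqfactS q_nil k) binS bin1.
have -> : (c.+1 * k.+1 + ('C(k.+1, 2) + k.+1)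
  = c * k.+1 + ('C(k.+1, 2) + k.+1) + k.+1)%N by lia.
have -> : (c * k.+1 + ('C(k.+1, 2) + k.+1)
  = c.+1 + (c.+1 * k + 'C(k.+1, 2)))%N by lia.
rewrite !exprD; ring.
Qed.

Lemma gf_part_lists k : gf (part_lists m k) = invqfact k.
Proof.
rewrite /gf; elim: k => [|k IHk]; first by rewrite big_seq1.
rewrite part_listsS big_allpairs_dep -[iota _ _]/(index_iota 0 m.+1).
rewrite big_mkord /= mulrC -IHk mulr_suml; apply: eq_bigr => i _.
rewrite mulr_sumr; apply: eq_bigr => l _.
by rewrite sumn_cat sumn_nseq exprD mulnC.
Qed.

(** Changing the sign of the rank exchanges the two sides, so only |z| matters. *)
Lemma gf_concave_lists z :
  gf (concave_lists m z) = q ^+ 'C(`|z|%N.+1, 2) * concave_sum q m `|z|%N m.+1.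
Proof.
rewrite /gf /concave_lists !big_allpairs_dep.
rewrite -![iota _ _]/(index_iota 0 m.+1) big_mkord mulr_sumr.
apply: eq_bigr => r _; rewrite big_mkord.
transitivity (\sum_(c < m.+1) q ^+ c * (gf (strict_lists c (m - c) r)
      * gf (strict_lists c (m - c) (r + `|z|)))).
  apply: eq_bigr => c _; rewrite big_allpairs_dep /=.
  transitivity (q ^+ c * (gf (strict_lists c (m - c) (left_size z r))
      * gf (strict_lists c (m - c) (right_size z r)))).
    rewrite /gf mulr_suml mulr_sumr; apply: eq_bigr => a _.
    rewrite mulr_sumr mulr_sumr; apply: eq_bigr => b _.
    by rewrite /join_concave sumn_cat sumn_rev /= !exprD; ring.
  by rewrite /left_size /right_size; case: ifP => // _; rewrite [X in _ * X]mulrC.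
rewrite /concave_term /geom !mulr_sumr; apply: eq_bigr => c _.
rewrite !gf_strict_lists ?subnKC -1?ltnS //.
move: (invqfact r) (invqfact (r + _)) => A B; move: `|z|%N => l.
(* Each of the 2r + l + 1 parts contributes c, and the triangular numbers satisfy T_r + T_(r+l) =
   T_l + r(r+l+1). *)
have E : (c + (c * r + 'C(r.+1, 2)) + (c * (r + l) + 'C((r + l).+1, 2)) =
   'C(l.+1, 2) + r * (r + l.+1) + c * (r + r + l).+1)%N.
  have tri k : (2 * 'C(k.+1, 2) = k * k.+1)%N.
    by elim: k => // k IHk; rewrite binS bin1; lia.
  by have := tri r; have := tri l; have := tri (r + l)%N; nia.
transitivity (q ^+ (c + (c * r + 'C(r.+1, 2)) + (c * (r + l) + 'C((r + l).+1, 2)))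
  * (A * B)); first by rewrite !exprD; ring.
by rewrite E !exprD; ring.
Qed.

End GeneratingFunctions.

(** * Extraction of the coefficient of q^n *)

(** The ring is Z[X]/(X^(n+1)), and [cf] reads the coefficient of X^n in the reduced
    representative. *)
Lemma truncated_series n : exists (R : comNzRingType) (q : R) (cf : {additive R -> int}),
  q ^+ n.+1 = 0 /\ (forall k, cf (q ^+ k) = (k == n)%:R).
Proof.
pose R := {poly %/ ('X^(n.+1) : {poly int})}.
pose q : R := in_qpoly 'X^(n.+1) 'X.
have h : mk_monic ('X^(n.+1) : {poly int}) = 'X^(n.+1) by rewrite mk_monic_Xn.
have qk k : q ^+ k = in_qpoly 'X^(n.+1) 'X^k.
  by rewrite rmorphXn.
have q0 : q ^+ n.+1 = 0.
  rewrite qk; apply/val_inj => /=; rewrite h; exact: Pdiv.RingMonic.rmodpp (monicXn _ _).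
exists R, q, (coefp n \o (@polyn _ _ : R -> {poly int})); split=> // k /=.
have [le_kn|lt_nk] := leqP k n; last first.
  by rewrite -(subnK lt_nk) exprD q0 mulr0 coef0; lia.
by rewrite qk in_qpoly_small ?h ?size_polyXn // coefXn eq_sym.
Qed.

Section Coefficients.
Variables (n : nat) (R : comNzRingType) (q : R) (cf : {additive R -> int}).
Hypothesis cfX : forall k, cf (q ^+ k) = (k == n)%:R.

Lemma cf_gf L : cf (gf q L) = (count (fun l => sumn l == n) L)%:R.
Proof.
rewrite /gf raddf_sum -sum1_count natr_sum [RHS]big_mkcond /=.
by apply: eq_bigr => l _; rewrite cfX; case: eqP.
Qed.

(** The factor q^e shifts the partition series by e. For e > n nothing survives, matching the value
    0 of [p] at negative arguments. *)
Lemma cf_partition e :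
  q ^+ n.+1 = 0 -> cf (invqfact q n n * q ^+ e) = (p (n%:Z - e%:Z))%:Z.
Proof.
move=> q_nil; rewrite -(gf_part_lists q n) /gf mulr_suml raddf_sum.
have [le_en|lt_ne] := leqP e n; last first.
  rewrite big1 => [|l _]; last by rewrite -exprD cfX; lia.
  by case E : (n%:Z - e%:Z) => //; lia.
rewrite subzn // /p (part_natE (leq_subr e n)) -sum1_count -[RHS]natz natr_sum [RHS]big_mkcond /=.
apply: eq_bigr => l _; rewrite -exprD cfX.
have -> : (sumn l == n - e)%N = (sumn l + e == n)%N by lia.
by case: eqP.
Qed.

End Coefficients.

(** * The formula for the number of compositions of given rank *)

Lemma Vd_nat_formula (l : int) (n J : nat) : (n < J)%N ->
  (Vd_nat l n)%:Z = \sum_(j < J)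
    ((p (n%:Z - ('C(`|l|%N.+1, 2) + (6 * j * j + 2 * j + 3 * j * `|l|))%N%:Z))%:Z
    - (p (n%:Z - ('C(`|l|%N.+1, 2)
                   + (6 * j * j + 10 * j + 4 + (3 * j + 2) * `|l|))%N%:Z))%:Z).
Proof.
move=> lt_nJ; have [R [q [cf [q_nil cfX]]]] := truncated_series n.
rewrite Vd_natE -natz -(cf_gf cfX) (gf_concave_lists q_nil).
rewrite (concave_sum_eq q_nil _ _ lt_nJ) // mulr_sumr mulr_sumr raddf_sum.
apply: eq_bigr => j _; rewrite -!(cf_partition cfX _ q_nil) -raddfB.
by congr (cf _); rewrite !exprD; ring.
Qed.

Lemma p_neg z : z < 0 -> p z = 0%N.
Proof. by case: z. Qed.

Lemma triangularE k : ((k * k.+1) %/ 2 = 'C(k.+1, 2))%N.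
Proof. by rewrite bin2 divn2 mulnC. Qed.

Lemma kron_m3E j : [/\ kron_m3 (2 * (3 * j)).+1 = 1,
  kron_m3 (2 * (3 * j).+1).+1 = 0 & kron_m3 (2 * (3 * j).+2).+1 = -1].
Proof.
rewrite /kron_m3; have -> : ((2 * (3 * j)).+1 %% 3 = 1)%N by lia.
have -> : ((2 * (3 * j).+1).+1 %% 3 = 0)%N by lia.
by have -> : ((2 * (3 * j).+2).+1 %% 3 = 2)%N by lia.
Qed.

(** Groups the indices by residue modulo 3, which determines the Kronecker symbol. *)
Lemma sum_triples (V : zmodType) (f : nat -> V) J :
  \sum_(i < 3 * J) f i = \sum_(j < J) (f (3 * j)%N + f (3 * j).+1%N + f (3 * j).+2%N).
Proof.
elim: J => [|J IHJ]; first by rewrite muln0 !big_ord0.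
have -> : (3 * J.+1 = (3 * J).+3)%N by lia.
by rewrite !big_ord_recr /= IHJ !addrA.
Qed.

Theorem proposition1 :
  (forall N l : int,
     exists M : nat, forall K : nat, (M <= K)%N ->
       ((V_d l (N + ((`|l|%N * (`|l|%N).+1) %/ 2)%N%:Z))%:Z =
        \sum_(n < K) kron_m3 (2 * n).+1 *
          (p (N - ((2 * n * n.+1) %/ 3)%N%:Z - (n * `|l|%N)%N%:Z))%:Z))
  /\
  (forall m n : int, 0 <= n ->
     n < ((`|m|%N * (`|m|%N + 5)) %/ 2 + 4)%N%:Z ->
     V_d m n = p (n - ((`|m|%N * (`|m|%N).+1) %/ 2)%N%:Z)).
Proof.
have formula (N l : int) : exists M : nat, forall K : nat, (M <= K)%N ->
    ((V_d l (N + ((`|l|%N * (`|l|%N).+1) %/ 2)%N%:Z))%:Z =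
     \sum_(n < K) kron_m3 (2 * n).+1 *
       (p (N - ((2 * n * n.+1) %/ 3)%N%:Z - (n * `|l|%N)%N%:Z))%:Z).
  rewrite triangularE; set T := 'C(_, 2).
  pose f n := kron_m3 (2 * n).+1 *
    (p (N - ((2 * n * n.+1) %/ 3)%N%:Z - (n * `|l|%N)%N%:Z))%:Z.
  (* If N + T < 0 then N < 0 as well, and every partition number in the sum is 0. *)
  case E : (N + T%:Z) => [n|n]; last first.
    exists 0%N => K _; rewrite big1 //= => i _.
    by rewrite p_neg ?mulr0 //; lia.
  (* These are n + 1 triples, matching J = n + 1 in [Vd_nat_formula]. From i = 3(n+1) on, 2i(i+1)/3
     > n >= N, so the terms vanish. *)
  exists (3 * n.+1)%N => K le_K.
  transitivity (\sum_(i < 3 * n.+1) f i); last first.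
    rewrite -(subnK le_K); elim: (K - _)%N => //= i IHi.
    rewrite addSn [RHS]big_ord_recr -IHi /= p_neg ?mulr0 ?addr0 //; nia.
  rewrite sum_triples /V_d (@Vd_nat_formula _ _ n.+1) //.
  apply: eq_bigr => j _; rewrite /f.
  have [-> -> ->] := kron_m3E j; rewrite mul1r mul0r addr0 mulN1r.
  congr ((p _)%:Z - (p _)%:Z).
    have -> : ((2 * (3 * j) * (3 * j).+1) %/ 3 = 6 * j * j + 2 * j)%N.
      rewrite (_ : 2 * (3 * j) * (3 * j).+1 = 3 * (6 * j * j + 2 * j))%N ?mulKn //; lia.
    lia.
  have -> : ((2 * (3 * j).+2 * (3 * j).+3) %/ 3 = 6 * j * j + 10 * j + 4)%N.
    rewrite (_ : 2 * (3 * j).+2 * (3 * j).+3 = 3 * (6 * j * j + 10 * j + 4))%N ?mulKn //; lia.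
  lia.
split=> // m n n_ge0 lt_n.
(* With [M.+2] terms, indices 0 and 1 can be split off; the symbol is 1 at the first and 0 at the
   second. *)
have [M /(_ M.+2)] := formula (n - ((`|m|%N * (`|m|%N).+1) %/ 2)%N%:Z) m.
rewrite subrK -addn2 leq_addr addn2 => /(_ isT).
rewrite !big_ord_recl /= mul1r mul0r add0r big1 ?addr0 => [|i _].
  by case.
(* The bound on n says that the argument at index 2 is negative: |m|(|m|+1)/2 + 4 + 2|m| =
   |m|(|m|+5)/2 + 4. Later arguments are smaller still. *)
rewrite p_neg ?mulr0 //=.
rewrite /bump /=; nia.
Qed.
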